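(* Let $p$ be a prime, $k\ge1$, and let $G=(V,E)$ be a connected graph with vertices ordered $v_1,\dots,v_n$ and edge-labeling $\alpha:E\to\{\text{ideals of }\mathbb{Z}/p^k\mathbb{Z}\}$. Let $\mathbf{b}^{(i)},\mathbf{b}^{(j)}$ be splines in the minimum generating set $\mathbb{B}_{p^k}$ described in the context, such that the nonzero entries of $\mathbf{b}^{(i)}$ are $p^s$ and those of $\mathbf{b}^{(j)}$ are $p^r$, where $s\le r<k$. Then (with entrywise multiplication) \[\mathbf{b}^{(i)}\mathbf{b}^{(j)}=\begin{cases}p^s\,\mathbf{b}^{(j)}&\text{if }\operatorname{supp}(\mathbf{b}^{(i)})\cap\operatorname{supp}(\mathbf{b}^{(j)})\neq\emptyset\text{ and }s+r<k,\\ \mathbf{0}&\text{if }\operatorname{supp}(\mathbf{b}^{(i)})\cap\operatorname{supp}(\mathbf{b}^{(j)})\neq\emptyset\text{ and }s+r\ge k,\\ \mathbf{0}&\text{if }\operatorname{supp}(\mathbf{b}^{(i)})\cap\operatorname{supp}(\mathbf{b}^{(j)})=\emptyset.\end{cases}\]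
   Context: For a commutative ring $R$, a finite connected graph $G$ and an edge-labeling $\alpha$ assigning to each edge an ideal of $R$, a spline is $\mathbf{f}\in R^{|V|}$ with $\mathbf{f}_u-\mathbf{f}_v\in\alpha(uv)$ for every edge $uv$; splines form a ring under entrywise operations. The support $\operatorname{supp}(\mathbf{f})$ of a spline is the set of vertices where it is nonzero. For $1\le\gamma\le k$, $\alpha_\gamma$ is the reduction of $\alpha$ via $\mathbb{Z}/p^k\mathbb{Z}\to\mathbb{Z}/p^\gamma\mathbb{Z}$; a zero-connected component of $(G,\alpha_\gamma)$ is a class of vertices joined by paths of edges whose label is the zero ideal; $V^{(i,\gamma)}$ is the zero-connected component of $(G,\alpha_\gamma)$ with smallest-index vertex $v_i$, and $I_\gamma$ is the set of such indices ($I_0=\emptyset$). $\mathbb{B}_{p^k}$ consists of, for each $1\le\gamma\le k$ and each $i\in I_\gamma\setminus I_{\gamma-1}$, the spline over $\mathbb{Z}/p^k\mathbb{Z}$ with value $p^{\gamma-1}$ on $V^{(i,\gamma)}$ and $0$ elsewhere. *)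

(* Defs.v *)
From mathcomp Require Import all_boot all_order all_algebra.
From mathcomp Require Import zify.

Set Implicit Arguments.
Unset Strict Implicit.
Unset Printing Implicit Defensive.

Import GRing.Theory.

Local Open Scope ring_scope.

(* [idealr_closed] of MathComp describes proper ideals only; edge labels may
   be the whole ring, so an ideal is taken to be a submodule of [R^o]. *)
Definition is_ideal (R : comNzRingType) (I : {pred R}) : Prop :=
  @GRing.submod_closed R R^o I.

Record connected_graph (n : nat) (e : rel 'I_n) : Prop := ConnectedGraph {
  graph_nonempty : (0 < n)%N;
  graph_sym : symmetric e;
  graph_irr : irreflexive e;
  graph_connected : forall u v, connect e u v
}.

(* The label of the edge uv is [alpha u v]; the values of [alpha] at non-edges
   are irrelevant. *)
Record edge_labeling (R : finComNzRingType) (n : nat) (e : rel 'I_n)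
    (alpha : 'I_n -> 'I_n -> {set R}) : Prop := EdgeLabeling {
  label_sym : forall u v, e u v -> alpha u v = alpha v u;
  label_ideal : forall u v, e u v -> is_ideal (mem (alpha u v))
}.

Definition is_spline (R : finComNzRingType) (n : nat) (e : rel 'I_n)
    (alpha : 'I_n -> 'I_n -> {set R}) (f : {ffun 'I_n -> R}) : Prop :=
  forall u v, e u v -> f u - f v \in alpha u v.

Definition supp (R : nzRingType) (n : nat) (f : {ffun 'I_n -> R}) : {set 'I_n} :=
  [set u | f u != 0].

(* The canonical map Z/m -> Z/d; meaningful when 1 < d and d divides m. *)
Definition Zp_red (m d : nat) (x : 'Z_m) : 'Z_d := (x : nat)%:R.

Definition red_label (p k n : nat) (alpha : 'I_n -> 'I_n -> {set 'Z_(p ^ k)})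
    (gamma : nat) (u v : 'I_n) : {set 'Z_(p ^ gamma)} :=
  [set Zp_red (p ^ gamma) x | x in alpha u v].

Definition zero_edge (p k n : nat) (e : rel 'I_n)
    (alpha : 'I_n -> 'I_n -> {set 'Z_(p ^ k)}) (gamma : nat) : rel 'I_n :=
  [rel u v | e u v && (red_label alpha gamma u v == [set 0])].

Definition zero_comp (p k n : nat) (e : rel 'I_n)
    (alpha : 'I_n -> 'I_n -> {set 'Z_(p ^ k)}) (gamma : nat) (i : 'I_n)
    : {set 'I_n} :=
  [set j | connect (zero_edge e alpha gamma) i j].

(* I_0 is empty by convention; the case is separated because 'Z_(p ^ 0) is
   not the zero ring. *)
Definition lead_indices (p k n : nat) (e : rel 'I_n)
    (alpha : 'I_n -> 'I_n -> {set 'Z_(p ^ k)}) (gamma : nat) : {set 'I_n} :=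
  if gamma is 0%N then set0
  else [set i | [forall j in zero_comp e alpha gamma i, (i <= j)%N]].

Definition comp_spline (p k n : nat) (e : rel 'I_n)
    (alpha : 'I_n -> 'I_n -> {set 'Z_(p ^ k)}) (gamma : nat) (i : 'I_n)
    : {ffun 'I_n -> 'Z_(p ^ k)} :=
  [ffun j => if j \in zero_comp e alpha gamma i then p%:R ^+ gamma.-1 else 0].

Definition min_gen_set (p k n : nat) (e : rel 'I_n)
    (alpha : 'I_n -> 'I_n -> {set 'Z_(p ^ k)}) : {set {ffun 'I_n -> 'Z_(p ^ k)}} :=
  \bigcup_(1 <= gamma < k.+1)
    [set comp_spline e alpha gamma i
       | i in lead_indices e alpha gamma :\: lead_indices e alpha gamma.-1].

Lemma ideal_pfactor (p k gamma : nat) (I : {set 'Z_(p ^ k)}) :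
  prime p -> (0 < gamma <= k)%N -> is_ideal (mem I) ->
  [set Zp_red (p ^ gamma) x | x in I] != [set 0] ->
  p%:R ^+ gamma.-1 \in I.
Proof.
move=> pp /andP[g0 gk] [I0 Ilin] In0.
have k0 : (0 < k)%N by lia.
have pk1 : (1 < p ^ k)%N by rewrite -(exp1n k) ltn_exp2r ?prime_gt1.
have pg1 : (1 < p ^ gamma)%N by rewrite -(exp1n gamma) ltn_exp2r ?prime_gt1.
have IM (a x : 'Z_(p ^ k)) : x \in I -> a * x \in I.
  by move=> xI; have := Ilin a x 0 xI I0; rewrite addr0.
have [x xI xn0] : exists2 x, x \in I & Zp_red (p ^ gamma) x != 0.
  apply/exists_inP; apply: contraR In0 => /exists_inPn h.
  apply/eqP/setP => y; rewrite inE; apply/imsetP/eqP => [[x xI ->]|->].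
    by apply/eqP; have := h x xI; rewrite negbK.
  by exists 0 => //; rewrite /Zp_red /=.
have ndvd : ~~ (p ^ gamma %| x)%N.
  apply: contra xn0 => dv; rewrite /Zp_red -val_eqE /= val_Zp_nat //.
have [j jk gE] : exists2 j, (j <= k)%N & gcdn (p ^ k) x = (p ^ j)%N.
  by apply/dvdn_pfactor => //; rewrite dvdn_gcdl.
have jg : (j <= gamma.-1)%N.
  rewrite leqNgt; apply: contra ndvd => lt.
  have: (p ^ j %| x)%N by rewrite -gE dvdn_gcdr.
  by apply: dvdn_trans; apply: dvdn_exp2l; lia.
have pkn0 : (0 < p ^ k)%N by lia.
have [a _ dv] := Bezoutl x pkn0.
have pjE : p%:R ^+ j = - (a%:R) * x :> 'Z_(p ^ k).
  apply/eqP; rewrite mulNr -addr_eq0 -natrX -gE.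
  rewrite -[x in _ * x]natr_Zp -natrM -natrD.
  by rewrite -val_eqE /= val_Zp_nat.
rewrite -(subnK jg) exprD; apply: (IM).
by rewrite pjE; apply: IM.
Qed.

Lemma min_gen_set_spline (p k n : nat) (e : rel 'I_n)
    (alpha : 'I_n -> 'I_n -> {set 'Z_(p ^ k)}) (f : {ffun 'I_n -> 'Z_(p ^ k)}) :
  prime p -> connected_graph e -> edge_labeling e alpha ->
  f \in min_gen_set e alpha -> is_spline e alpha f.
Proof.
move=> pp [_ esym _ _] [asym aid].
rewrite /min_gen_set big_nat.
elim/big_ind: _ => [|A B hA hB|g /andP[g0 gk]]; first by rewrite inE.
  by rewrite inE => /orP[/hA|/hB].
case/imsetP => i _ -> u v euv.
have [I0 Ilin] := aid u v euv.
rewrite !ffunE !inE.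
have csym : symmetric (zero_edge e alpha g).
  move=> a b; rewrite /zero_edge /red_label /= esym.
  by have [eba|] := boolP (e b a); rewrite //= (asym b a).
have [ze|nze] := boolP (zero_edge e alpha g u v).
  rewrite (same_connect_r (sym_connect_sym csym) (connect1 ze)).
  by rewrite subrr.
have pI : p%:R ^+ g.-1 \in alpha u v.
  apply: ideal_pfactor => //; first by rewrite g0 -ltnS.
  by move: nze; rewrite /zero_edge /= euv.
do 2!case: ifP => _; rewrite ?subrr ?sub0r ?subr0 //.
by have := Ilin (-1) _ 0 pI I0; rewrite addr0 scaleN1r.
Qed.

(* Main.v *)
(* Reducing modulo a smaller power of p creates more zero labels, so a
   zero-connected component at level r+1 that meets one at level s+1 <= r+1 is
   contained in it; hence b^(i) is constantly p^s on the support of b^(j). *)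
Require Import Defs.
From mathcomp Require Import all_boot all_order all_algebra.

Set Implicit Arguments.
Unset Strict Implicit.
Unset Printing Implicit Defensive.

Import GRing.Theory.
Local Open Scope ring_scope.

Lemma Zp_red_eq0 (m d : nat) (x : 'Z_m) :
  (1 < d)%N -> (Zp_red d x == 0) = (d %| x)%N.
Proof. by move=> d1; rewrite /Zp_red -val_eqE /= val_Zp_nat. Qed.

Lemma pfactor_Zp_eq0 (p k m : nat) :
  prime p -> (0 < k)%N -> ((p%:R ^+ m : 'Z_(p ^ k)) == 0) = (k <= m)%N.
Proof.
move=> pp k0; have p1 := prime_gt1 pp.
have pk1 : (1 < p ^ k)%N by rewrite -(expn0 p) ltn_exp2l.
by rewrite -natrX -val_eqE /= val_Zp_nat // -/(dvdn _ _) dvdn_Pexp2l.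
Qed.

(** For exponents below [k] the powers of [p] are smaller than [p ^ k], hence are their own
    residues. This lets the level of a generator be read off from its nonzero value. *)
Lemma pfactor_Zp_inj (p k a b : nat) :
  prime p -> (a < k)%N -> (b < k)%N ->
  p%:R ^+ a = p%:R ^+ b :> 'Z_(p ^ k) -> a = b.
Proof.
move=> pp ak bk; have p1 := prime_gt1 pp.
have k0 : (0 < k)%N by apply: leq_ltn_trans ak.
have pk1 : (1 < p ^ k)%N by rewrite -(expn0 p) ltn_exp2l.
rewrite -!natrX => /(congr1 val); rewrite /= !val_Zp_nat //.
by rewrite !modn_small ?ltn_exp2l // => /eqP; rewrite eqn_exp2l // => /eqP.
Qed.

(** A label is zero modulo [p ^ delta] when [p ^ delta] divides all its elements, and then
    [p ^ gamma] divides them too. *)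
Lemma zero_edge_mono (p k n : nat) (e : rel 'I_n)
    (alpha : 'I_n -> 'I_n -> {set 'Z_(p ^ k)}) (gamma delta : nat) :
  prime p -> (0 < gamma <= delta)%N ->
  subrel (zero_edge e alpha delta) (zero_edge e alpha gamma).
Proof.
move=> pp /andP[g0 gd] u v; rewrite /zero_edge /= => /andP[-> /eqP labE] /=.
have p1 := prime_gt1 pp.
have pow_gt1 m : (0 < m)%N -> (1 < p ^ m)%N.
  by move=> m0; rewrite -(expn0 p) ltn_exp2l.
have red0 x : x \in alpha u v -> Zp_red (p ^ gamma) x = 0.
  move=> xI; have /set1P/eqP : Zp_red (p ^ delta) x \in [set 0].
    by rewrite -labE; apply: imset_f.
  rewrite Zp_red_eq0 ?pow_gt1 ?(leq_trans g0) // => dv.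
  by apply/eqP; rewrite Zp_red_eq0 ?pow_gt1 // (dvdn_trans _ dv) ?dvdn_exp2l.
(* The reduced label must be [[set 0]] and not empty: a preimage of 0 at level [delta] gives an
   element of [alpha u v], which also maps to 0 at level [gamma]. *)
have /imsetP[x xI _] : 0 \in red_label alpha delta u v by rewrite labE set11.
apply/eqP/setP => y; rewrite inE; apply/imsetP/eqP => [[z zI ->]|->].
  exact: red0.
by exists x; rewrite ?red0.
Qed.

Lemma zero_edge_sym (p k n : nat) (e : rel 'I_n)
    (alpha : 'I_n -> 'I_n -> {set 'Z_(p ^ k)}) (gamma : nat) :
  connected_graph e -> edge_labeling e alpha ->
  symmetric (zero_edge e alpha gamma).
Proof.
move=> hG halpha u v; rewrite /zero_edge /red_label /= (graph_sym hG).
(* Labels are symmetric on edges only; at a non-edge both sides are false. *)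
by have [evu|//] := boolP (e v u); rewrite (label_sym halpha evu).
Qed.

(** From [i] one reaches [w] at level [gamma], then goes back to [j] and on to any [u] along zero
    edges of level [delta], which are also zero edges of level [gamma]. *)
Lemma zero_comp_sub (p k n : nat) (e : rel 'I_n)
    (alpha : 'I_n -> 'I_n -> {set 'Z_(p ^ k)}) (gamma delta : nat)
    (i j w : 'I_n) :
  prime p -> connected_graph e -> edge_labeling e alpha ->
  (0 < gamma <= delta)%N ->
  w \in zero_comp e alpha gamma i -> w \in zero_comp e alpha delta j ->
  zero_comp e alpha delta j \subset zero_comp e alpha gamma i.
Proof.
move=> pp hG halpha gd; rewrite !inE => iw jw; apply/subsetP => u.
rewrite !inE => ju; apply: connect_trans iw _.
apply: (connect_sub (e := zero_edge e alpha delta)) => [a b ab|].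
  exact/connect1/(zero_edge_mono pp gd).
apply: connect_trans ju.
by rewrite (sym_connect_sym (zero_edge_sym _ hG halpha)).
Qed.

(** Membership in the generating set gives some level [gamma]. The value at [i], which lies in its
    own component, is [p ^ gamma.-1]; it is nonzero since [gamma.-1 < k], so it equals [p ^ s] and
    forces [gamma = s.+1]. *)
Lemma min_gen_set_comp_spline (p k n : nat) (e : rel 'I_n)
    (alpha : 'I_n -> 'I_n -> {set 'Z_(p ^ k)}) (f : {ffun 'I_n -> 'Z_(p ^ k)})
    (s : nat) :
  prime p -> (s < k)%N -> f \in min_gen_set e alpha ->
  (forall u, u \in supp f -> f u = p%:R ^+ s) ->
  exists i, f = comp_spline e alpha s.+1 i.
Proof.
move=> pp sk fB fs.
have [gamma [i [/andP[g0 gk] fE]]] : exists gamma i,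
    (0 < gamma <= k)%N /\ f = comp_spline e alpha gamma i.
  move: fB; rewrite /min_gen_set big_nat.
  elim/big_ind: _ => [|A B hA hB|g gk]; first by rewrite inE.
    by rewrite inE => /orP[/hA|/hB].
  by case/imsetP => i _ ->; exists g, i.
have gk' : (gamma.-1 < k)%N by rewrite prednK.
have fi : f i = p%:R ^+ gamma.-1 by rewrite fE ffunE inE connect0.
have si : i \in supp f.
  by rewrite inE fi pfactor_Zp_eq0 ?(leq_trans g0) // -ltnNge.
exists i; rewrite fE -(prednK g0); congr (comp_spline _ _ _.+1 _).
by apply: (@pfactor_Zp_inj p k) => //; rewrite -fi fs.
Qed.

Theorem theorem5p5 (p k n : nat) (hp : prime p) (hk : (1 <= k)%N)
    (e : rel 'I_n) (hG : connected_graph e)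
    (alpha : 'I_n -> 'I_n -> {set 'Z_(p ^ k)}) (halpha : edge_labeling e alpha)
    (bi bj : {ffun 'I_n -> 'Z_(p ^ k)})
    (hbi : bi \in min_gen_set e alpha) (hbj : bj \in min_gen_set e alpha)
    (s r : nat)
    (hs : forall u : 'I_n, u \in supp bi -> bi u = p%:R ^+ s)
    (hr : forall u : 'I_n, u \in supp bj -> bj u = p%:R ^+ r)
    (hsr : (s <= r)%N) (hrk : (r < k)%N) :
  [/\ supp bi :&: supp bj != set0 -> (s + r < k)%N ->
        bi * bj = bj *+ (p ^ s),
      supp bi :&: supp bj != set0 -> (k <= s + r)%N ->
        bi * bj = 0
    & supp bi :&: supp bj = set0 ->
        bi * bj = 0].
Proof.
have k_gt0 : (0 < k)%N := hk.
have [i bE] :=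
  min_gen_set_comp_spline hp (leq_ltn_trans hsr hrk) hbi hs.
have [j cE] := min_gen_set_comp_spline hp hrk hbj hr.
split=> [/set0Pn[w] | _ ksr | disj].
- rewrite !inE bE cE !ffunE => /andP[]; case: ifP; rewrite ?eqxx // => iw _.
  case: ifP; rewrite ?eqxx // => jw _ _.
  have levels : (0 < s.+1 <= r.+1)%N by [].
  have /subsetP sub := zero_comp_sub hp hG halpha levels iw jw.
  apply/ffunP => u; rewrite ffunMnE !ffunE /=.
  (* Off the support of [bj] both sides vanish; on it, the inclusion [sub] gives [bi] the value
     [p ^ s]. *)
  have [/sub -> | _] := boolP (u \in zero_comp e alpha r.+1 j); last first.
    by rewrite mulr0 mul0rn.
  by rewrite -natrX mulr_natl.
- apply/ffunP => u; rewrite bE cE !ffunE /=.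
  case: ifP => _; rewrite ?mul0r //; case: ifP => _; rewrite ?mulr0 //.
  (* Where both factors are nonzero the product is [p ^ (s + r)], which is 0 modulo [p ^ k]. *)
  by apply/eqP; rewrite -exprD pfactor_Zp_eq0.
(* Disjoint supports mean that at each vertex one of the two factors is 0. *)
apply/ffunP => u; rewrite !ffunE; have := in_set0 u; rewrite -disj !inE.
by case: eqP => [-> | _ /negbFE/eqP ->]; rewrite ?mul0r ?mulr0.
Qed.
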